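(* For every integer $k\geq 24$, the only tight $(k,0)$-stable graphs are the complete graphs $K_{k+1}$ and $K_{k+2}$ (up to isomorphism).
   Context: All graphs are finite, simple and undirected. $\alpha(G)$ denotes the independence number of $G$ (with $\alpha=0$ for the graph with no vertices), and $G-S$ denotes the subgraph of $G$ induced on $V(G)\setminus S$. For integers $k>\ell\geq 0$, a graph $G$ is $(k,\ell)$-stable if for every $S\subseteq V(G)$ with $|S|=k$ we have $\alpha(G-S)\geq \alpha(G)-\ell$. A $(k,\ell)$-stable graph $G$ on $n$ vertices is tight if $\alpha(G)=\left\lfloor \frac{n-k+1}{2}\right\rfloor+\ell$. *)

(* Defs.v *)
From mathcomp Require Import all_boot all_order all_algebra.
Set Implicit Arguments.
Unset Strict Implicit.
Unset Printing Implicit Defensive.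

Record sgraph := SGraph {
  vertex :> finType;
  edge : rel vertex;
  edge_sym : symmetric edge;
  edge_irr : irreflexive edge
}.

Definition iso (G H : sgraph) : Prop :=
  exists2 f : G -> H, bijective f & {mono f : x y / edge x y}.

Section Induced.
Variables (G : sgraph) (A : {set G}).

Definition induced_edge : rel {x : G | x \in A} :=
  [rel x y | edge (val x) (val y)].

Lemma induced_sym : symmetric induced_edge.
Proof. by move=> x y; apply: edge_sym. Qed.

Lemma induced_irr : irreflexive induced_edge.
Proof. by move=> x; apply: edge_irr. Qed.

Definition induced : sgraph := SGraph induced_sym induced_irr.
End Induced.

Definition del (G : sgraph) (S : {set G}) : sgraph := induced (~: S).

Section Complete.
Variable n : nat.

Definition complete_edge : rel 'I_n := [rel x y | x != y].

Lemma complete_sym : symmetric complete_edge.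
Proof. by move=> x y; rewrite /complete_edge /= eq_sym. Qed.

Lemma complete_irr : irreflexive complete_edge.
Proof. by move=> x; rewrite /complete_edge /= eqxx. Qed.

Definition complete : sgraph := SGraph complete_sym complete_irr.
End Complete.

Definition independent (G : sgraph) (A : {set G}) : bool :=
  [forall x in A, forall y in A, ~~ edge x y].

Definition alpha (G : sgraph) : nat :=
  \max_(A : {set G} | independent A) #|A|.

(* Truncated subtraction is harmless here, since alpha is nonnegative. *)
Definition stable (k l : nat) (G : sgraph) : Prop :=
  forall S : {set G}, #|S| = k -> alpha G - l <= alpha (del S).

(* The equation is stated over int, where %/ 2 is the floor: #|G| may be
   smaller than k, and with truncated subtraction on nat the graph without
   vertices would count as tight. *)
Definition tight (k l : nat) (G : sgraph) : Prop :=
  stable k l G /\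
  ((alpha G)%:Z = ((#|G|%:Z - k%:Z + 1) %/ 2)%Z + l%:Z)%R.

(* Main.v *)
(* Deleting edges while [alpha G] does not change preserves stability, so one
   may assume every edge critical. Write f(X) = |N(X)| - |X|. Intersecting with
   a maximum independent set does not increase f, so by criticality f is
   minimized over nonempty independent sets at a single vertex, and stability
   gives degrees at least k, hence f >= k - 1 there; intersections of maximum
   independent sets have f <= |G| - 2 alpha <= k. For a vertex x and each
   neighbour w take X_w such that X_w + x and X_w + w are maximum independent.
   The two bounds on f force any three of the X_w to have empty intersection.
   Counting inside G - N[x] gives
   deg x * (alpha - 1) <= 2 (|G| - 1 - deg x) <= 2 (2 alpha - 1),
   hence alpha <= 1. *)

Require Import Defs.
From mathcomp Require Import all_boot all_order all_algebra.
From mathcomp Require Import zify.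
Set Implicit Arguments.
Unset Strict Implicit.
Unset Printing Implicit Defensive.

(** * Independent sets and the independence number *)

Lemma independentP (G : sgraph) (A : {set G}) :
  reflect {in A &, forall x y, ~~ edge x y} (independent A).
Proof.
apply: (iffP forall_inP) => [indA x y xA yA | indA x xA].
  exact: (forall_inP (indA x xA)).
by apply/forall_inP => y yA; apply: indA.
Qed.

Lemma independentS (G : sgraph) (A B : {set G}) :
  A \subset B -> independent B -> independent A.
Proof.
move=> /subsetP sAB /independentP indB; apply/independentP => x y xA yA.
exact: indB (sAB x xA) (sAB y yA).
Qed.

Lemma independent0 (G : sgraph) : independent (set0 : {set G}).
Proof. by apply/independentP => x y; rewrite inE. Qed.

Lemma independent1 (G : sgraph) (x : G) : independent [set x].
Proof.
by apply/independentP => y z /set1P-> /set1P->; rewrite edge_irr.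
Qed.

Lemma leq_alpha (G : sgraph) (A : {set G}) : independent A -> #|A| <= alpha G.
Proof. exact: (@leq_bigmax_cond _ _ (fun A : {set G} => #|A|)). Qed.

Lemma alpha_witness (G : sgraph) :
  exists2 A : {set G}, independent A & #|A| = alpha G.
Proof.
have [|A indA eqA] := @eq_bigmax_cond {set G} (@independent G) (fun A => #|A|).
  by apply/card_gt0P; exists set0; exact: independent0.
by exists A.
Qed.

Lemma alpha_gt0 (G : sgraph) : (0 < alpha G) = (0 < #|G|).
Proof.
apply/idP/card_gt0P => [agt0 | [x _]].
  have [A _ cA] := alpha_witness G.
  by case/card_gt0P: (leq_trans agt0 (eq_leq (esym cA))) => x _; exists x.
by rewrite -(cards1 x) leq_alpha ?independent1.
Qed.

Lemma alpha_le1P (G : sgraph) :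
  reflect (forall x y : G, edge x y = (x != y)) (alpha G <= 1).
Proof.
apply: (iffP idP) => [ale1 x y | cG].
  apply/idP/idP => [exy | neq_xy].
    by apply: contraTneq exy => ->; rewrite edge_irr.
  apply: contraTT ale1 => nexy; rewrite -ltnNge.
  have <-: #|[set x; y]| = 2 by rewrite cards2 neq_xy.
  apply: leq_alpha; apply/independentP => u v /set2P[]-> /set2P[]->;
    by rewrite ?edge_irr // edge_sym.
have [A /independentP indA <-] := alpha_witness G.
apply/card_le1P => x xA y; rewrite inE; apply/idP/eqP => [yA | -> //].
by apply/eqP; rewrite -[y == x]negbK -cG indA.
Qed.

Lemma iso_completeP (G : sgraph) n :
  iso G (complete n) <-> #|G| = n /\ forall x y : G, edge x y = (x != y).
Proof.
split=> [[f bij_f mono_f] | [cG eG]].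
  split=> [|x y]; first by rewrite (bij_eq_card bij_f) card_ord.
  by rewrite -mono_f -[LHS]/(f x != f y) (inj_eq (bij_inj bij_f)).
exists (cast_ord cG \o enum_rank).
  by apply: bij_comp; [exists (cast_ord (esym cG)) => i; apply: val_inj
                      | exact: enum_rank_bij].
move=> x y; rewrite eG -[LHS]/(cast_ord cG _ != cast_ord cG _).
by rewrite (inj_eq (@cast_ord_inj _ _ _)) (inj_eq enum_rank_inj).
Qed.

(** * Vertex deletion and stability *)

Lemma leq_alpha_del (G : sgraph) (S A : {set G}) :
  independent A -> [disjoint A & S] -> #|A| <= alpha (del S).
Proof.
move=> /independentP indA disAS.
pose B : {set del S} := [set u | val u \in A].
have <-: #|B| = #|A|.
  rewrite -(card_imset _ val_inj); congr #|pred_of_set _|.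
  apply/setP => x; apply/imsetP/idP => [[u] | xA]; first by rewrite inE => ? ->.
  have xS : x \in ~: S by rewrite inE (disjointFr disAS).
  by exists (Sub x xS); rewrite ?inE.
by apply/leq_alpha/independentP => u v; rewrite !inE; apply: indA.
Qed.

Lemma alpha_del_witness (G : sgraph) (S : {set G}) :
  exists A : {set G}, [/\ independent A, [disjoint A & S] & #|A| = alpha (del S)].
Proof.
have [B /independentP indB cB] := alpha_witness (del S).
exists (val @: B); split; last by rewrite (card_imset _ val_inj).
  by apply/independentP => _ _ /imsetP[u uB ->] /imsetP[v vB ->]; apply: indB.
rewrite disjoint_subset; apply/subsetP => _ /imsetP[u _ ->].
by have := valP u; rewrite !inE.
Qed.

(** Stability with no loss, phrased with vertex sets of [G] itself so that it passes to graphs on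
    the same vertices with fewer edges. *)
Definition robust k (G : sgraph) :=
  forall S : {set G}, #|S| <= k ->
  exists A : {set G}, [/\ independent A, [disjoint A & S] & alpha G <= #|A|].

Lemma superset_card (T : finType) (S : {set T}) k :
  #|S| <= k <= #|T| -> exists2 S' : {set T}, S \subset S' & #|S'| = k.
Proof.
case/andP=> leSk lekT; have [m] := ubnP (k - #|S|).
elim: m => // m IHm in S leSk *; rewrite ltnS => lem.
have [eqSk | neqSk] := eqVneq #|S| k; first by exists S.
have [x /= xS | SE] := pickP [pred x | x \notin S].
  have [||S' sS' cS'] := IHm (x |: S); try by rewrite cardsU1 xS; lia.
  by exists S' => //; apply: subset_trans sS'; apply: subsetUr.
have : #|S| = #|T| by apply: eq_card => x; move/negbFE: (SE x).
by lia.
Qed.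

(** A smaller [S] is enlarged to exactly [k] vertices. On fewer than [k] vertices [stable] is
    vacuous, hence the size hypothesis. *)
Lemma stable_robust k (G : sgraph) : k <= #|G| -> stable k 0 G -> robust k G.
Proof.
move=> lekG stG S leSk; have [|S' sS' cS'] := @superset_card _ S k.
  by rewrite leSk.
have [A [indA disA cA]] := alpha_del_witness S'.
exists A; split=> //; first exact: disjointWr disA.
by have := stG _ cS'; rewrite cA subn0.
Qed.

(** * Neighbourhoods and exchange with a maximum independent set *)

Definition nbhd (G : sgraph) (X : {set G}) : {set G} :=
  [set y | [exists x in X, edge x y]].

Lemma nbhdP (G : sgraph) (X : {set G}) y :
  reflect (exists2 x, x \in X & edge x y) (y \in nbhd X).
Proof. by rewrite inE; apply: (iffP exists_inP). Qed.

Lemma nbhdS (G : sgraph) (X Y : {set G}) : X \subset Y -> nbhd X \subset nbhd Y.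
Proof.
move=> /subsetP sXY; apply/subsetP => y /nbhdP[x xX exy].
by apply/nbhdP; exists x => //; apply: sXY.
Qed.

Lemma in_nbhd1 (G : sgraph) (x y : G) : (y \in nbhd [set x]) = edge x y.
Proof. by apply/nbhdP/idP => [[_ /set1P->] | exy] //; exists x; rewrite ?inE. Qed.

Lemma independent_nbhd (G : sgraph) (X : {set G}) :
  independent X -> [disjoint X & nbhd X].
Proof.
move=> /independentP indX; rewrite disjoint_subset; apply/subsetP => y yX.
by rewrite !inE; apply/exists_inP => -[x xX]; apply/negP/indX.
Qed.

Definition max_independent (G : sgraph) (A : {set G}) :=
  independent A && (#|A| == alpha G).

(* Replacing [I :&: nbhd X] by [X :\: I] in [I] keeps it independent. *)
Lemma nbhdI_max (G : sgraph) (I X : {set G}) :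
  max_independent I -> independent X ->
  #|nbhd (X :&: I)| + #|X| <= #|nbhd X| + #|X :&: I|.
Proof.
case/andP=> indI /eqP cI indX.
have indIX : independent ((I :\: nbhd X) :|: X).
  apply/independentP => x y /setUP[/setDP[xI xN]|xX] /setUP[/setDP[yI yN]|yX].
  - exact: (independentP _ indI).
  - by apply: contra xN => exy; apply/nbhdP; exists y => //; rewrite edge_sym.
  - by apply: contra yN => exy; apply/nbhdP; exists x.
  - exact: (independentP _ indX).
have := leq_alpha indIX; rewrite cardsU -cI.
have -> : (I :\: nbhd X) :&: X = X :&: I.
  apply/setP => x; rewrite !in_setI in_setD.
  by case xX: (x \in X); rewrite ?andbF // (disjointFr (independent_nbhd indX)) // andbT.
(* As [I] is independent, [nbhd (X :&: I)] misses [I], while the exchange puts at least [#|X :\: I|]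
   vertices of [nbhd X] in [I]. *)
have : nbhd (X :&: I) \subset nbhd X :\: I.
  rewrite subsetD nbhdS ?subsetIl //=.
  have sXI := subsetIr X I; rewrite disjoint_sym.
  rewrite disjoint_subset; apply/subsetP => y yI; rewrite inE.
  apply/negP => /nbhdP[x /setIP[_ xI]]; apply/negP.
  exact: (independentP _ indI).
move/subset_leq_card; have := cardsID (nbhd X) I; have := cardsID I (nbhd X).
rewrite [nbhd X :&: I]setIC.
have := subset_leq_card (subsetIl X I); lia.
Qed.

(** * Edge-critical graphs *)

(* [x |: (y |: X)] witnesses that deleting the edge [xy] increases [alpha G]. *)
Definition critical (G : sgraph) :=
  forall x y : G, edge x y ->
  exists X : {set G}, [/\ x \notin X, y \notin X,
    max_independent (x |: X) & max_independent (y |: X)].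

(** Take an inclusion-minimal symmetric set of edges of [G] under which no set larger than [alpha G]
    is independent. *)
Lemma critical_subgraph (G : sgraph) :
  exists (e : rel G) (e_sym : symmetric e) (e_irr : irreflexive e),
    let H := SGraph e_sym e_irr in
    [/\ subrel e (@edge G), alpha H = alpha G & critical H].
Proof.
pose ind (E : {set G * G}) (A : {set G}) :=
  [forall x in A, [forall y in A, (x, y) \notin E]].
have indP (E : {set G * G}) (A : {set G}) :
    reflect {in A &, forall x y, (x, y) \notin E} (ind E A).
  apply: (iffP forall_inP) => [h x y xA yA | h x xA].
    exact: (forall_inP (h x xA)).
  by apply/forall_inP => y yA; apply: h.
pose E0 : {set G * G} := [set p | edge p.1 p.2].
pose P (E : {set G * G}) :=
  [&& E \subset E0, [forall x, forall y, ((x, y) \in E) == ((y, x) \in E)]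
    & [forall A : {set G}, ind E A ==> (#|A| <= alpha G)]].
have PE0 : P E0.
  apply/and3P; split=> //.
    by apply/forallP => x; apply/forallP => y; rewrite !inE /= edge_sym.
  apply/forallP => A; apply/implyP => /indP indA.
  apply: leq_alpha; apply/independentP => x y xA yA.
  by have := indA x y xA yA; rewrite inE.
have [E /minsetP[/and3P[sE symE aE] minE] _] := minset_exists PE0.
pose e : rel G := fun x y => (x, y) \in E.
have e_sym : symmetric e by move=> x y; apply/eqP/(forallP (forallP symE x)).
have sub_e : subrel e (@edge G) by move=> x y /(subsetP sE); rewrite inE.
have e_irr : irreflexive e.
  by move=> x; apply/negP => /sub_e; rewrite edge_irr.
exists e, e_sym, e_irr => H.
have aH : alpha H = alpha G.
  apply/eqP; rewrite eqn_leq; apply/andP; split.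
    have [A /independentP indA <-] := alpha_witness H.
    by apply: (implyP (forallP aE A)); apply/indP.
  have [A /independentP indA <-] := alpha_witness G.
  apply: (@leq_alpha H); apply/independentP => x y xA yA.
  by apply: contra (indA x y xA yA); apply: sub_e.
split=> // x y exy.
have neq_xy : x != y by apply: contraTneq exy => ->; rewrite edge_irr.
pose E' := E :\: [set (x, y); (y, x)].
have sE' : E' \subset E by apply: subsetDl.
(* [E'] drops both orientations of the edge, so it stays symmetric and can only fail [P] through a
   large independent set [A]. *)
have : ~~ P E'.
  apply/negP => /minE /(_ sE') eqE; have: (x, y) \in E' by rewrite eqE.
  by rewrite !inE eqxx.
rewrite /P (subset_trans sE' sE) /= negb_and => /orP[|/forallPn[A]].
  case/forallPn => u /forallPn[v] /negP[]; rewrite !inE !xpair_eqE.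
  have := e_sym u v; rewrite /e => ->.
  by rewrite (andbC (u == x)) (andbC (u == y)) [(v == y) && _ || _]orbC.
rewrite negb_imply -ltnNge => /andP[/indP indA ltA].
(* Without one end of [xy], [A] is independent in [H], so has at most [alpha G] elements; thus [A]
   contains both ends and has size [alpha G + 1]. *)
have maxD (z : G) : z \in [set x; y] -> z \in A /\ @max_independent H (A :\ z).
  move=> zxy.
  have indAz : @independent H (A :\ z).
    apply/independentP => u v /setD1P[uz uA] /setD1P[vz vA].
    have := indA u v uA vA; rewrite !inE !xpair_eqE negb_and negbK.
    case/orP => //; case/set2P: zxy uz vz => ->;
      by do 2![move=> /negbTE->]; rewrite ?andbF.
  have leA : #|A :\ z| <= alpha G by rewrite -aH; apply: leq_alpha indAz.
  have := cardsD1 z A; case: (z \in A) => /= cA; last by lia.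
  split=> //; apply/andP; split=> //; rewrite aH; apply/eqP.
  by rewrite -[LHS]/#|A :\ z|; lia.
have [xA maxx] := maxD x (set21 _ _); have [yA maxy] := maxD y (set22 _ _).
exists (A :\ x :\ y); split; rewrite ?inE ?eqxx ?andbF //.
  suff -> : x |: (A :\ x :\ y) = A :\ y by [].
  by rewrite setDDl [_ :|: [set y]]setUC -setDDl setD1K // !inE neq_xy.
suff -> : y |: (A :\ x :\ y) = A :\ x by [].
by rewrite setD1K // !inE eq_sym neq_xy.
Qed.

Lemma robust_subgraph k (G : sgraph) (e : rel G) (e_sym : symmetric e)
    (e_irr : irreflexive e) (H := SGraph e_sym e_irr) :
  subrel e (@edge G) -> alpha H = alpha G -> robust k G -> robust k H.
Proof.
move=> sub_e aH robG S leS; have [A [/independentP indA disA leA]] := robG S leS.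
exists A; split; rewrite ?aH //; apply/independentP => x y xA yA.
by apply: contra (indA x y xA yA); apply: sub_e.
Qed.

(** Otherwise the closed neighbourhood of [x] has at most [k] vertices, and a maximum independent
    set avoiding it could be extended by [x]. *)
Lemma robust_degree k (G : sgraph) (x : G) :
  robust k G -> k <= #|nbhd [set x]|.
Proof.
move=> robG; rewrite leqNgt; apply/negP => ltk.
have [|A [/independentP indA disA leA]] := robG (x |: nbhd [set x]).
  by rewrite cardsU1; case: (x \notin _) => /=; lia.
have xA : x \notin A by apply/negP => /(disjointFr disA); rewrite !inE eqxx.
suff /leq_alpha : independent (x |: A) by rewrite cardsU1 xA; lia.
have nx y : y \in A -> ~~ edge x y.
  by move/(disjointFr disA); rewrite in_setU1 in_nbhd1 => /norP[].
apply/independentP => u v /setU1P[->|uA] /setU1P[->|vA]; rewrite ?edge_irr //.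
- exact: nx.
- by rewrite edge_sym nx.
- exact: indA.
Qed.

(* In a minimal counterexample [X] containing [x], intersecting [X] with the
   two maximum independent sets of a critical edge at [x] yields [X] and
   [X :\ x]. *)
Lemma robust_nbhd k (G : sgraph) (X : {set G}) :
  0 < k -> robust k G -> critical G -> independent X -> X != set0 ->
  #|X| + k <= #|nbhd X|.+1.
Proof.
move=> k_gt0 robG critG; have [m] := ubnP #|X|.
elim: m => // m IHm in X *; rewrite ltnS => leXm indX.
case/set0Pn => x xX; have kx := robust_degree x robG.
have [y] : exists y, y \in nbhd [set x].
  by apply/card_gt0P; apply: leq_trans k_gt0 kx.
rewrite in_nbhd1 => exy; have [Z [xZ yZ maxx maxy]] := critG x y exy.
have shrink I : max_independent I -> X :&: I != set0 -> X :&: I != X ->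
    #|X| + k <= #|nbhd X|.+1.
  move=> maxI XI0 XIX; have := nbhdI_max maxI indX.
  have sXI := subsetIl X I.
  have ltXI : #|X :&: I| < #|X| by apply: proper_card; rewrite properEneq XIX.
  have := IHm (X :&: I) (leq_trans ltXI leXm) (independentS sXI indX) XI0.
  by lia.
have [XZ | nXZ] := eqVneq (X :&: (x |: Z)) X; last first.
  by apply: shrink maxx _ nXZ; apply/set0Pn; exists x; rewrite !inE xX eqxx.
(* Now [X] lies in [x |: Z]. If it misses [y |: Z], it is [[set x]] and the degree bound applies; if
   not, the second intersection is nonempty and omits [x]. *)
have [XZ0 | nXZ0] := eqVneq (X :&: (y |: Z)) set0.
  suff -> : X = [set x] by rewrite cards1; lia.
  apply/setP => z; rewrite inE; apply/idP/eqP => [zX | -> //].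
  move: (zX); rewrite -XZ !inE => /andP[_ /orP[/eqP//|zZ]].
  by move/setP/(_ z): XZ0; rewrite !inE zX zZ orbT.
apply: shrink maxy nXZ0 _; apply: contraNneq xZ => XE.
move: (xX); rewrite -XE !inE => /andP[_ /orP[/eqP xy|//]].
by move: exy; rewrite xy edge_irr.
Qed.

(* If the intersection [Q] were nonempty, adding [x] to it would add the three
   [w]s to its neighbourhood and so raise [#|nbhd Q| - #|Q|] by at least 2, to
   at least [k + 1]; but [x |: Q] is an intersection of maximum independent
   sets, for which this difference is at most [#|G| - 2 * alpha G <= k]. *)
Lemma critical_triple k (G : sgraph) (x w1 w2 w3 : G) (X1 X2 X3 : {set G}) :
  0 < k -> robust k G -> critical G -> #|G| <= 2 * alpha G + k ->
  edge x w1 -> edge x w2 -> edge x w3 ->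
  w1 != w2 -> w1 != w3 -> w2 != w3 ->
  x \notin X1 ->
  max_independent (x |: X1) -> max_independent (x |: X2) ->
  max_independent (x |: X3) ->
  independent (w1 |: X1) -> independent (w2 |: X2) -> independent (w3 |: X3) ->
  X1 :&: X2 :&: X3 = set0.
Proof.
move=> k_gt0 robG critG leG e1 e2 e3 n12 n13 n23 xX1 max1 max2 max3 i1 i2 i3.
apply/eqP; apply/negPn/negP => Q0; set Q := X1 :&: X2 :&: X3 in Q0.
have xQ : x \notin Q by rewrite !inE (negbTE xX1).
have [sQ1 sQ2 sQ3] : [/\ Q \subset X1, Q \subset X2 & Q \subset X3].
  by split; apply/subsetP => z; rewrite !inE => /andP[/andP[]].
have nQ (w : G) (X : {set G}) : Q \subset X -> independent (w |: X) ->
    w \notin nbhd Q.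
  move=> /subsetP sQ /independentP indX; apply/nbhdP => -[z /sQ zX].
  by apply/negP/indX; rewrite !inE ?zX ?eqxx ?orbT.
have indQ : independent Q.
  by apply: independentS i1; apply: subset_trans sQ1 (subsetUr _ _).
have [ind1 /eqP c1] := andP max1.
have xQE : x |: Q = (x |: X1) :&: (x |: X2) :&: (x |: X3).
  by rewrite -!setUIr.
have ub : #|nbhd (x |: Q)| <= #|x |: Q| + k.
  have ind12 : independent ((x |: X1) :&: (x |: X2)).
    by apply: independentS ind1; apply: subsetIl.
  (* Two exchanges reduce the bound to [x |: X1], whose neighbourhood lies in its complement. *)
  have := nbhdI_max max2 ind1; have := nbhdI_max max3 ind12; rewrite -xQE.
  have := cardsUI (nbhd (x |: X1)) (x |: X1).
  rewrite disjoint_setI0 1?disjoint_sym ?independent_nbhd // cards0.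
  have : #|nbhd (x |: X1) :|: (x |: X1)| <= #|G| by apply: max_card.
  by move: leG c1; clear; lia.
have lb : #|nbhd Q| + 3 <= #|nbhd (x |: Q)|.
  have <- : #|[set w1; w2; w3]| = 3.
    by rewrite setUC cardsU1 !inE negb_or ![w3 == _]eq_sym n13 n23 cards2 n12.
  rewrite -cardsUI [_ :&: _](_ : _ = set0) ?cards0 ?addn0.
    apply/subset_leq_card/subsetP => z /setUP[|zw].
      exact/subsetP/nbhdS/subsetUr.
    apply/nbhdP; exists x; first exact: setU11.
    by case/setUP: zw => [/set2P[]|/set1P] ->.
  apply/setP => z; rewrite in_set0 in_setI; apply/andP => -[zQ].
  case/setUP => [/set2P[]|/set1P] zE; move: zQ; rewrite zE; apply/negP.
  - exact: nQ sQ1 i1.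
  - exact: nQ sQ2 i2.
  - exact: nQ sQ3 i3.
have := robust_nbhd k_gt0 robG critG indQ Q0.
by move: ub lb; rewrite cardsU1 xQ; clear; lia.
Qed.

(** * Double counting around a vertex *)

Lemma critical_robust_alpha k (G : sgraph) :
  6 < k -> robust k G -> critical G -> #|G| <= 2 * alpha G + k ->
  alpha G <= 1.
Proof.
move=> k_gt6 robG critG leG; have [G0 | [x _]] := set_0Vmem [set: G].
  by rewrite leqNgt; apply/negP => /ltnW; rewrite alpha_gt0 -cardsT G0 cards0.
pose N := nbhd [set x].
pose good (w : G) (X : {set G}) := [&& x \notin X, w \notin X,
  max_independent (x |: X) & max_independent (w |: X)].
have /fin_all_exists [F FP] : forall w : G, exists X : {set G}, w \in N -> good w X.
  (* Outside [N] the value of [F] is a dummy. *)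
  move=> w; have [wN|_] := boolP (w \in N); last by exists set0.
  have [|X [? ? ? ?]] := critG x w; first by rewrite -in_nbhd1.
  by exists X => _; apply/and4P.
pose M : {set G} := ~: (x |: N).
have edgeN w : w \in N -> edge x w by rewrite in_nbhd1.
have cF w : w \in N -> #|F w|.+1 = alpha G.
  case/FP/and4P => xX _ /andP[_ /eqP <-] _.
  by rewrite cardsU1 xX.
have FM w : w \in N -> F w \subset M.
  case/FP/and4P => xX _ /andP[/independentP indX _] _.
  apply/subsetP => z zX; rewrite in_setC in_setU1 in_nbhd1 negb_or.
  rewrite (contraNneq _ xX) => [/=|<- //].
  by rewrite indX ?setU11 // setU1r.
have count2 z : #|[set w in N | z \in F w]| <= 2.
  rewrite leqNgt; apply/negP => /card_gt2P[w1 [w2 [w3 [[]]]]].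
  move=> /setIdP[w1N z1] /setIdP[w2N z2] /setIdP[w3N z3] [n12 n23 n31].
  have [/and4P[x1 _ m1 /andP[i1 _]] /and4P[_ _ m2 /andP[i2 _]]] :=
    (FP _ w1N, FP _ w2N).
  have /and4P[_ _ m3 /andP[i3 _]] := FP _ w3N.
  have := @critical_triple k G x w1 w2 w3 (F w1) (F w2) (F w3).
  rewrite !edgeN // [w1 == w3]eq_sym n12 n23 n31.
  move=> /(_ (leq_trans _ k_gt6) robG critG leG isT isT isT isT isT isT).
  by move=> /(_ isT x1 m1 m2 m3 i1 i2 i3)/setP/(_ z); rewrite !inE z1 z2 z3.
(* Count the pairs of [w] in [N] and [z] in [F w], first by [w], then by [z]. *)
have dbl : \sum_(w in N) #|F w| <= 2 * #|M|.
  rewrite (eq_bigr (fun w => \sum_(z in M) (z \in F w))) => [|w wN]; last first.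
    rewrite -sum1_card big_mkcond [RHS]big_mkcond /=; apply: eq_bigr => z _.
    case zF: (z \in F w); last by case: ifP.
    by rewrite (subsetP (FM w wN) z zF).
  rewrite exchange_big /= mulnC -sum_nat_const; apply: leq_sum => z _.
  apply: leq_trans (count2 z); rewrite -sum1_card big_mkcond [leqRHS]big_mkcond.
  apply/eq_leq/eq_bigr => w _; rewrite in_set.
  by case: (w \in N); case: (z \in F w).
have kN : k <= #|N| := robust_degree x robG.
have cM : #|M| + #|N| + 1 = #|G|.
  have := cardsC (x |: N); rewrite cardsU1 in_nbhd1 edge_irr /= -/M; lia.
have sumF : \sum_(w in N) #|F w| = #|N| * (alpha G).-1.
  by rewrite -sum_nat_const; apply: eq_bigr => w /cF <-.
(* With degree at least 7 this yields [7 * (alpha G - 1) <= 4 * alpha G - 2] when [alpha G] is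
   positive; degree 6 would still allow [alpha G = 2]. *)
move: dbl; rewrite sumF; nia.
Qed.

Lemma robust_alpha k (G : sgraph) :
  6 < k -> robust k G -> #|G| <= 2 * alpha G + k -> alpha G <= 1.
Proof.
have [e [e_sym [e_irr [sub_e aH critH]]]] := critical_subgraph G.
move=> k_gt6 robG; rewrite -aH => leG; apply: critical_robust_alpha leG => //.
exact: robust_subgraph robG.
Qed.

(** * Classification of the tight graphs *)

Theorem theorem1p3 (k : nat) (hk : 24 <= k) (G : sgraph) :
  tight k 0 G <-> iso G (complete k.+1) \/ iso G (complete k.+2).
Proof.
split=> [[stG eqa] | isoG].
  have a_gt0 := alpha_gt0 G.
  (* If [alpha G] were 0, [G] would be empty and the floor of [(1 - k) / 2] negative. So the floor
     is at least 1. *)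
  have ltkG : k < #|G| by lia.
  have /alpha_le1P cG : alpha G <= 1.
    apply: (@robust_alpha k); last by lia.
    - exact: leq_trans hk.
    - exact: stable_robust (ltnW ltkG) stG.
  have /alpha_le1P ale1 := cG.
  (* The floor equals 1, so [#|G| - k + 1] is 2 or 3. *)
  have [cardG | cardG] : #|G| = k.+1 \/ #|G| = k.+2 by lia.
  - by left; apply/iso_completeP.
  - by right; apply/iso_completeP.
have [cardG cG] : (#|G| = k.+1 \/ #|G| = k.+2) /\
    forall x y : G, edge x y = (x != y).
  by case: isoG => /iso_completeP[-> cG]; split=> //; [left | right].
have /alpha_le1P ale1 := cG; have a_gt0 := alpha_gt0 G.
split; last by lia.
(* One surviving vertex suffices, since [alpha G] is at most 1. *)
move=> S cS; have [x xS] : exists x, x \notin S.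
  apply/existsP; rewrite -negb_forall; apply/negP => /forallP allS.
  have : #|S| = #|G| by apply: eq_card => x; apply: allS.
  by lia.
apply: (@leq_trans 1); first by lia.
by rewrite -(cards1 x) leq_alpha_del ?independent1 // disjoints1.
Qed.
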